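(* Let $q$ be a prime power and let $(k_i)_{i\ge0}$, $(d_i)_{i\ge 0}$ be sequences of positive integers with $q\geq d_0k_0+1$ and, for all $i\geq 0$, $k_i\leq k_{i+1}$, $d_i\leq d_{i+1}$ and $q^{2^{i}}\geq d_{i+1}k_{i+1}+1$. Then, after suitable row and column permutations of each matrix (putting, at each step, the rows and columns of the previous matrix first), the sequence $(\mathbf{C}_{q^{2^{i}},k_i,d_i})_{i\geq 0}$ of permuted matrices $C_{q^{2^i},k_i,d_i}$ is an embedding family of incidence matrices of CFFs, where $C_{q^{2^i},k_i,d_i}$ is a $d_i$-CFF.
   Context: A $d$-CFF$(t,n)$ is a set system $(X,\mathcal{B})$, $|X|=t$, $|\mathcal{B}|=n$, $B\subseteq X$ for $B\in\mathcal B$, such that no member of $\mathcal{B}$ is contained in the union of any $d$ other members; it is represented by its $t\times n$ binary incidence matrix. For a prime power $r$ with the elements of $\mathbb{F}_r$ listed in a fixed order $x_1,\dots,x_r$, and positive integers $\kappa,\delta$ with $r\ge \delta\kappa+1$, the matrix $C_{r,\kappa,\delta}$ has rows indexed by pairs $(x_j,y)$ with $1\le j\le \delta\kappa+1$, $y\in\mathbb{F}_r$, columns indexed by polynomials $f\in\mathbb{F}_r[x]$ of degree at most $\kappa$, and entry $1$ iff $f(x_j)=y$. The fields are nested, $\mathbb{F}_{q^{2^i}}\subseteq\mathbb{F}_{q^{2^{i+1}}}$, and the ordering of $\mathbb{F}_{q^{2^{i+1}}}$ lists the elements of $\mathbb{F}_{q^{2^i}}$ first in the same order. An embedding family is a sequence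 $(\mathcal{M}^{(l)})_l$ of incidence matrices of set systems $(X_l,\mathcal{B}_l)$, where $\mathcal{M}^{(l)}$ is a $d(l)$-CFF, such that $X_l\subseteq X_{l+1}$, the numbers of rows and of columns are nondecreasing in $l$, $d(l)\le d(l+1)$, and $\mathcal{M}^{(l+1)}=\begin{pmatrix}\mathcal{M}^{(l)} & Y\\ Z& W\end{pmatrix}$ for some matrices $Y,Z,W$. *)

(* Defs.v *)
From HB Require Import structures.
From mathcomp Require Import all_boot all_order all_algebra all_fingroup.
From mathcomp Require Import finmap.

Set Implicit Arguments.
Unset Strict Implicit.
Unset Printing Implicit Defensive.

Import GRing.Theory.

Local Open Scope fset_scope.
Local Open Scope nat_scope.

Definition prime_power (q : nat) : Prop :=
  exists p e : nat, [/\ prime p, 0 < e & q = p ^ e].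

(** * Cover-free families *)

Definition CFF (U : choiceType) (d t n : nat)
    (X : {fset U}) (B : {fset {fset U}}) : Prop :=
  [/\ #|` X| = t,
      #|` B| = n,
      forall A, A \in B -> A `<=` X &
      forall (A : {fset U}) (S : {fset {fset U}}),
        A \in B -> S `<=` B `\ A -> #|` S| = d ->
        ~~ (A `<=` \bigcup_(A' <- S) A')].

(** [p] and [b] list the points and the blocks in the order in which they label
    the rows and the columns of [M]; the blocks labelling distinct columns are
    distinct. *)
Definition incidence_matrix (U : choiceType) (t n : nat) (M : 'M[bool]_(t, n))
    (X : {fset U}) (B : {fset {fset U}}) : Prop :=
  exists (p : t.-tuple U) (b : n.-tuple {fset U}),
    [/\ uniq p, uniq b, p =i X, b =i B &
        forall i j, M i j = (tnth p i \in tnth b j)].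

(** [M'] has the shape [(M Y; Z W)]. *)
Definition extends_mx (t n t' n' : nat)
    (M : 'M[bool]_(t, n)) (M' : 'M[bool]_(t', n')) : Prop :=
  exists (r c : nat) (et : t + r = t') (en : n + c = n')
         (Y : 'M[bool]_(t, c)) (Z : 'M[bool]_(r, n)) (W : 'M[bool]_(r, c)),
    M' = castmx (et, en) (block_mx M Y Z W).

Definition embedding_family (U : choiceType) (t n : nat -> nat)
    (M : forall l, 'M[bool]_(t l, n l))
    (X : nat -> {fset U}) (B : nat -> {fset {fset U}}) (d : nat -> nat) : Prop :=
  (forall l, incidence_matrix (M l) (X l) (B l)
             /\ CFF (d l) (t l) (n l) (X l) (B l))
  /\ (forall l, [/\ X l `<=` X l.+1, t l <= t l.+1, n l <= n l.+1,
                    d l <= d l.+1 & extends_mx (M l) (M l.+1)]).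

(** * The matrices [C_{r, kappa, delta}] *)

Section PolynomialMatrix.
Variables (F : finFieldType) (x : seq F) (kappa delta : nat).

(** The pairs [(x_j, y)], where [j] ranges over the first
    [delta * kappa + 1] positions of the list [x] of the elements of [F]. *)
Definition C_points : {set F * F} :=
  [set p : F * F | p.1 \in take (delta * kappa + 1) x].

(** [{poly_m F}] bounds the size, so this is degree at most [kappa]. *)
Definition C_poly : finType := {poly_kappa.+1 F}.

Definition C_row (a : 'I_#|C_points|) : F * F := enum_val a.
Definition C_col (b : 'I_#|C_poly|) : {poly F} :=
  polyn (enum_val b : {poly_kappa.+1 F}).

Definition C_mx : 'M[bool]_(#|C_points|, #|C_poly|) :=
  \matrix_(a, b) ((C_col b).[(C_row a).1] == (C_row a).2)%R.

(** The set system underlying [C_mx], with [F] read as a subfield of [L] through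
    [inc], so that the point sets for different subfields are comparable. *)
Variables (L : fieldType) (inc : {rmorphism F -> L}).

Definition pair_in (p : F * F) : L * L := (inc p.1, inc p.2).

Definition C_X : {fset L * L} := [fset pair_in p | p in C_points].

Definition C_block (f : {poly F}) : {fset L * L} :=
  [fset pair_in p | p in C_points & (f.[p.1] == p.2)%R].

Definition C_B : {fset {fset L * L}} :=
  [fset C_block (polyn f) | f : {poly_kappa.+1 F}].

End PolynomialMatrix.

(* Main.v *)
(** Two polynomials of degree at most k agree in at most k points, so the d k + 1
    points of a block are never covered by the at most d k points that it shares
    with d other blocks. Read inside the common field L, the points and the
    polynomials of each matrix are among those of the next one, since the lists of
    evaluation points are nested prefixes; the permutations are built recursively,
    listing first the rows (columns) already present in the order of the previous
    step. *)

Require Import Defs.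
From HB Require Import structures.
From mathcomp Require Import all_boot all_order all_algebra all_fingroup.
From mathcomp Require Import finmap.

Set Implicit Arguments.
Unset Strict Implicit.
Unset Printing Implicit Defensive.

Import GRing.Theory.

Local Open Scope nat_scope.

(** * Compatible orderings of nested finite labellings, and block extensions of matrices *)

Lemma labelling_inclusion (T : eqType) (m n : nat)
    (v : 'I_m -> T) (w : 'I_n -> T) :
  injective v -> (forall a, exists b, w b = v a) ->
  exists2 f : 'I_m -> 'I_n, injective f & forall a, w (f a) = v a.
Proof.
move=> v_inj v_w.
have wP a : exists b, w b == v a by have [b <-] := v_w a; exists b.
have fE a : w (xchoose (wP a)) = v a by apply/eqP/(xchooseP (wP a)).
exists (fun a => xchoose (wP a)) => // a b /(congr1 w).
by rewrite !fE => /v_inj.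
Qed.

Lemma leq_nested_labelling (T : eqType) (m n : nat)
    (v : 'I_m -> T) (w : 'I_n -> T) :
  injective v -> (forall a, exists b, w b = v a) -> m <= n.
Proof.
move=> v_inj /(labelling_inclusion v_inj)[f f_inj _].
by rewrite -(card_ord m) -(card_ord n) (leq_card f).
Qed.

(* The conclusion is boolean so that [sigW] can extract the permutation in the
   recursion over [i] below. *)
Lemma extend_labelling_perm (T : eqType) (m n : nat)
    (v : 'I_m -> T) (w : 'I_n -> T) (s : 'S_m) :
  injective v -> (forall a, exists b, w b = v a) ->
  exists s' : 'S_n,
    [forall a : 'I_m, forall b : 'I_n, (b == a :> nat) ==> (w (s' b) == v (s a))].
Proof.
move=> v_inj v_w.
(* Using [v \o s] rather than [v] makes [f] follow the order already fixed by [s]. *)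
have [|a|f f_inj fE] := @labelling_inclusion _ _ _ (v \o s) w.
- exact: inj_comp v_inj perm_inj.
- exact: v_w.
(* [t] rearranges all of ['I_n]: the old labels first, in the order of [f], then the rest. Reading
   it by position gives the permutation. *)
pose t := codom f ++ [seq b <- enum 'I_n | b \notin codom f].
have t_uniq : uniq t.
  rewrite cat_uniq filter_uniq ?enum_uniq // andbT map_inj_uniq ?enum_uniq //=.
  by apply/hasPn => b; rewrite mem_filter => /andP[].
have t_size : size t = n.
  rewrite -[RHS]size_enum_ord; apply/perm_size/uniq_perm; rewrite ?enum_uniq //.
  by move=> b; rewrite mem_cat mem_filter mem_enum andbT; case: (_ \in _).
(* The default [b] is never returned, as [t] has length [n]; it avoids choosing an element of a
   possibly empty ['I_n]. *)
have g_inj : injective (fun b : 'I_n => nth b t b).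
  move=> b c; rewrite (set_nth_default b) ?t_size // => /eqP.
  by rewrite nth_uniq ?t_size // => /eqP/val_inj.
exists (perm g_inj); apply/forallP=> a; apply/forallP=> b; apply/implyP=> /eqP ba.
rewrite permE nth_cat size_codom card_ord ba ltn_ord.
have -> : nth b (codom f) a = f a.
  by rewrite (nth_map a) ?size_enum_ord // nth_ord_enum.
by rewrite fE /=.
Qed.

(** Recursion on [i] from the identity: each permutation extends the one chosen before it. *)
Lemma nested_labelling_perms (T : eqType) (m : nat -> nat)
    (v : forall i, 'I_(m i) -> T) :
  (forall i, injective (v i)) ->
  (forall i a, exists b, v i.+1 b = v i a) ->
  exists s : forall i, 'S_(m i),
    forall i (a : 'I_(m i)) (b : 'I_(m i.+1)),
      b = a :> nat -> v i.+1 (s i.+1 b) = v i (s i a).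
Proof.
move=> v_inj v_nested.
have step i (s : 'S_(m i)) := sigW (extend_labelling_perm s (@v_inj i) (v_nested i)).
pose s := fix s i : 'S_(m i) := if i is j.+1 then sval (step j (s j)) else 1%g.
exists s => i a b ba.
have /forallP/(_ a)/forallP/(_ b)/implyP := svalP (step i (s i)).
by move=> /(_ (introT eqP ba))/eqP.
Qed.

(** [Y], [Z], [W] are read off as the other three blocks of [M']. *)
Lemma extends_mx_entries (t n t' n' : nat)
    (M : 'M[bool]_(t, n)) (M' : 'M[bool]_(t', n')) :
  t <= t' -> n <= n' ->
  (forall (a : 'I_t) (b : 'I_n) (a' : 'I_t') (b' : 'I_n'),
     a' = a :> nat -> b' = b :> nat -> M' a' b' = M a b) ->
  extends_mx M M'.
Proof.
move=> /subnKC; move: (t' - t) => r et /subnKC; move: (n' - n) => c en.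
subst t' n' => MM'; exists r, c, erefl, erefl.
exists (ursubmx M'), (dlsubmx M'), (drsubmx M').
rewrite castmx_id -[LHS]submxK; congr block_mx.
by apply/matrixP=> a b; rewrite !mxE; apply: MM'.
Qed.

(** * The cover-free property over a single field *)

Section PolynomialCFF.
Local Open Scope fset_scope.
Local Open Scope nat_scope.

Variables (F : finFieldType) (x : seq F) (k d : nat).
Variables (L : fieldType) (inc : {rmorphism F -> L}).
Hypothesis x_uniq : uniq x.
Hypothesis x_size : d * k + 1 <= size x.

Local Notation block := (C_block x k d inc).
Local Notation points := (C_points x k d).

Lemma pair_in_inj : injective (pair_in inc).
Proof. by move=> [a b] [a' b'] [/fmorph_inj-> /fmorph_inj->]. Qed.

Lemma mem_C_block (f : {poly F}) (p : F * F) :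
  (pair_in inc p \in block f) = (p \in points) && (f.[p.1] == p.2)%R.
Proof.
apply/imfsetP/idP => [[p' /= + /pair_in_inj ->]|pP].
  by rewrite inE.
by exists p; rewrite //= inE.
Qed.

(** A block is the graph of [f] over the evaluation points, hence has one element for each of
    them. *)
Lemma C_blockE (f : {poly F}) :
  block f =i [seq pair_in inc (a, f.[a]%R) | a <- take (d * k + 1) x].
Proof.
move=> z; apply/imfsetP/mapP => [[[a b] /=]|[a ax ->]].
  by rewrite !inE => /andP[/= ax /eqP <-] ->; exists a.
by exists (a, f.[a]%R) => //=; rewrite !inE /= ax eqxx.
Qed.

Lemma card_C_block (f : {poly F}) : #|` block f| = d * k + 1.
Proof.
have u : uniq [seq pair_in inc (a, f.[a]%R) | a <- take (d * k + 1) x].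
  by rewrite map_inj_uniq ?take_uniq // => a b /pair_in_inj[].
rewrite -(size_takel x_size) -(size_map (fun a => pair_in inc (a, f.[a]%R))).
by apply/perm_size/uniq_perm => //; apply: C_blockE.
Qed.

(** The first coordinates of common points are roots of the nonzero polynomial [f - g], of degree at
    most [k]. *)
Lemma card_C_blockI (f g : {poly F}) :
  size f <= k.+1 -> size g <= k.+1 -> f != g ->
  #|` block f `&` block g| <= k.
Proof.
move=> sf sg fg.
pose r := [seq a <- x | root (f - g)%R a].
have r_size : size r <= k.
  rewrite -ltnS; apply: (@leq_trans (size (f - g)%R)).
    by rewrite max_poly_roots ?subr_eq0 ?filter_all ?filter_uniq.
  by rewrite (leq_trans (size_polyD _ _)) // size_polyN geq_max sf.
apply: leq_trans r_size.
rewrite -(size_map (fun a => pair_in inc (a, f.[a]%R))).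
apply: uniq_leq_size => // z.
rewrite in_fsetI C_blockE => /andP[/mapP[a ax ->]].
rewrite mem_C_block => /andP[_ /eqP /= gf].
apply: map_f.
by rewrite mem_filter (mem_take ax) andbT rootE hornerD hornerN gf subrr.
Qed.

Lemma card_fsetI_bigcup_le (U : choiceType) (m : nat) (A : {fset U})
    (S : seq {fset U}) :
  (forall A', A' \in S -> #|` A `&` A'| <= m) ->
  #|` A `&` \bigcup_(A' <- S) A'| <= size S * m.
Proof.
elim: S => [|A' S IH] AS; first by rewrite big_nil fsetI0 cardfs0.
rewrite big_cons fsetIUr mulSn (leq_trans (leq_card_fsetU _ _)) //.
by rewrite leq_add ?AS ?mem_head // IH // => B BS; rewrite AS // inE BS orbT.
Qed.

(** Distinct polynomials with the same block would share [d * k + 1 > k] points. *)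
Lemma C_block_inj (d_gt0 : 0 < d) (f g : {poly_k.+1 F}) :
  block f = block g -> f = g.
Proof.
move=> fg; apply/val_inj/eqP; case: eqP => // /eqP ne.
have := card_C_blockI (size_npoly f) (size_npoly g) ne.
rewrite fg fsetIid card_C_block addn1 leqNgt ltnS.
by rewrite leq_pmull.
Qed.

Lemma C_CFF (d_gt0 : 0 < d) :
  CFF d #|points| #|C_poly F k| (C_X x k d inc) (C_B x k d inc).
Proof.
split.
- by rewrite card_imfset //=; [rewrite -cardE | apply: pair_in_inj].
- rewrite card_imfset /=; last exact: C_block_inj.
  by rewrite -cardE.
- move=> _ /imfsetP[f _ ->]; apply/fsubsetP => _ /imfsetP[p + ->].
  rewrite inE => /andP[px _].
  by apply/imfsetP; exists p.
(* A covered block equals its intersection with the union, which would force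
   [d * k + 1 <= d * k]. *)
- move=> _ S /imfsetP[f _ ->] SB Sd; apply/negP => /fsetIidPl cover.
  have: #|` block f `&` \bigcup_(A' <- S) A'| <= size S * k.
    apply: card_fsetI_bigcup_le => A' /(fsubsetP SB).
    rewrite !inE => /andP[ne /imfsetP[g _ defA']]; rewrite defA' in ne *.
    apply: card_C_blockI (size_npoly f) (size_npoly g) _.
    by apply: contraNneq ne => ->.
  by rewrite cover card_C_block Sd addn1 ltnn.
Qed.

Lemma C_incidence (d_gt0 : 0 < d) (s : 'S_#|points|) (u : 'S_#|C_poly F k|) :
  incidence_matrix (row_perm s (col_perm u (C_mx x k d)))
    (C_X x k d inc) (C_B x k d inc).
Proof.
exists [tuple pair_in inc (C_row (s a)) | a < _].
exists [tuple block (C_col (u b)) | b < _].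
split.
- rewrite map_inj_uniq ?enum_uniq //.
  by move=> a b /pair_in_inj/enum_val_inj/perm_inj.
- rewrite map_inj_uniq ?enum_uniq //.
  by move=> a b /(C_block_inj d_gt0)/enum_val_inj/perm_inj.
- move=> z; apply/mapP/imfsetP => [[a _ ->]|[p /= px ->]].
    by exists (C_row (s a)) => //=; apply: enum_valP.
  exists (s^-1%g (enum_rank_in px p)); rewrite ?mem_enum //.
  by rewrite permKV /C_row enum_rankK_in.
- move=> z; apply/mapP/imfsetP => [[b _ ->]|[f _ ->]].
    by exists (enum_val (u b)).
  exists (u^-1%g (enum_rank f)); rewrite ?mem_enum //.
  by rewrite permKV /C_col enum_rankK.
- move=> a b; rewrite !mxE !tnth_mktuple mem_C_block.
  by rewrite /C_row enum_valP.
Qed.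

End PolynomialCFF.

(** * Comparison of two successive fields inside [L] *)

Section NestedFields.
Variables (F F' : finFieldType) (x : seq F) (x' : seq F') (k k' d d' : nat).
Variables (L : fieldType) (inc : {rmorphism F -> L}) (inc' : {rmorphism F' -> L}).
Hypothesis F_nested : forall y : F, exists z : F', inc' z = inc y.
Hypothesis kk' : k <= k'.

Lemma C_col_inj : injective (fun b => map_poly inc (@C_col F k b)).
Proof. by move=> b c /map_poly_inj/val_inj/enum_val_inj. Qed.

Lemma nested_C_col (b : 'I_#|C_poly F k|) :
  exists b' : 'I_#|C_poly F' k'|,
    map_poly inc' (C_col b') = map_poly inc (C_col b).
Proof.
have zP y : exists z, inc' z == inc y by have [z <-] := F_nested y; exists z.
pose h y := xchoose (zP y).
have hE y : inc' (h y) = inc y by apply/eqP/(xchooseP (zP y)).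
(* [h] lifts single coefficients and is not packaged as a morphism; fixing 0 is enough for
   [map_poly h] to act coefficientwise. *)
have h0 : h 0%R = 0%R by apply: (fmorph_inj inc'); rewrite hE !rmorph0.
pose g := map_poly h (C_col b).
have g_size : size g <= k'.+1.
  apply: leq_trans (size_poly _ _) _.
  by apply: leq_trans (size_npoly _) _; rewrite ltnS.
exists (enum_rank (npolyp k'.+1 g)); rewrite /C_col enum_rankK npolypK //.
by apply/polyP => j; rewrite !coef_map /= coef_map_id0.
Qed.

Hypothesis dd' : d <= d'.
Hypothesis x_size : d * k + 1 <= size x.
Hypothesis x_prefix : prefix (map inc x) (map inc' x').

Lemma nested_C_points p :
  p \in C_points x k d ->
  exists2 p', p' \in C_points x' k' d' & pair_in inc' p' = pair_in inc p.
Proof.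
case: p => a y; rewrite inE /= => ax.
have [z zE] := F_nested y.
have /mapP[a' a'x aE] : inc a \in map inc' (take (d' * k' + 1) x').
  have le : d * k + 1 <= d' * k' + 1 by rewrite leq_add2r leq_mul.
  (* The first [d * k + 1] entries of the two lists agree in [L], and the longer initial segment
     contains them. *)
  have -> : map inc' (take (d' * k' + 1) x') =
            map inc (take (d * k + 1) x) ++
            drop (d * k + 1) (map inc' (take (d' * k' + 1) x')).
    rewrite -{1}(cat_take_drop (d * k + 1) (map inc' _)); congr (_ ++ _).
    rewrite !map_take take_takel //.
    by move: x_prefix => /prefixP[r ->]; rewrite takel_cat ?size_map.
  by rewrite mem_cat map_f.
exists (a', z); first by rewrite inE.
by rewrite /pair_in /= zE aE.
Qed.

Lemma nested_C_row (a : 'I_#|C_points x k d|) :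
  exists a' : 'I_#|C_points x' k' d'|,
    pair_in inc' (C_row a') = pair_in inc (C_row a).
Proof.
have [p p_in pE] := nested_C_points (enum_valP a).
by exists (enum_rank_in p_in p); rewrite /C_row enum_rankK_in.
Qed.

Lemma nested_C_X : (C_X x k d inc `<=` C_X x' k' d' inc')%fset.
Proof.
apply/fsubsetP => _ /imfsetP[p /nested_C_points[p' p'x pE] ->].
by apply/imfsetP; exists p'.
Qed.

End NestedFields.

(** Field morphisms are injective and commute with evaluation, so both incidences can be tested in
    [L], where they are the same equation. *)
Lemma nested_horner_eq (F F' : finFieldType) (L : fieldType)
    (inc : {rmorphism F -> L}) (inc' : {rmorphism F' -> L})
    (p : F * F) (p' : F' * F') (f : {poly F}) (f' : {poly F'}) :
  pair_in inc' p' = pair_in inc p -> map_poly inc' f' = map_poly inc f ->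
  (f'.[p'.1] == p'.2)%R = (f.[p.1] == p.2)%R.
Proof.
move=> [aE yE] fE; rewrite -(inj_eq (fmorph_inj inc)) -(inj_eq (fmorph_inj inc')).
by rewrite -!horner_map fE aE yE.
Qed.


Theorem theorem4
  (q : nat) (q_pp : prime_power q)
  (k d : nat -> nat)
  (k_gt0 : forall i, 0 < k i) (d_gt0 : forall i, 0 < d i)
  (q_ge : d 0 * k 0 + 1 <= q)
  (k_mono : forall i, k i <= k i.+1)
  (d_mono : forall i, d i <= d i.+1)
  (qi_ge : forall i, d i.+1 * k i.+1 + 1 <= q ^ (2 ^ i))
  (* the nested fields of order q ^ (2 ^ i), inside a common field L *)
  (L : fieldType) (F : nat -> finFieldType)
  (inc : forall i, {rmorphism F i -> L})
  (card_F : forall i, #|F i| = q ^ (2 ^ i))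
  (F_nested : forall i (y : F i), exists z : F i.+1, inc i.+1 z = inc i y)
  (* the compatible orderings of these fields *)
  (x : forall i, seq (F i))
  (x_enum : forall i, perm_eq (x i) (enum (F i)))
  (x_prefix : forall i, prefix (map (inc i) (x i)) (map (inc i.+1) (x i.+1))) :
  exists (s : forall i, 'S_#|C_points (x i) (k i) (d i)|)
         (u : forall i, 'S_#|C_poly (F i) (k i)|),
    [/\ (* the rows of the previous matrix come first, in the same order *)
        forall i (a : 'I_#|C_points (x i) (k i) (d i)|)
                 (a' : 'I_#|C_points (x i.+1) (k i.+1) (d i.+1)|),
          a' = a :> nat ->
          pair_in (inc i.+1) (C_row (s i.+1 a')) = pair_in (inc i) (C_row (s i a)),
        (* the columns of the previous matrix come first, in the same order *)
        forall i (b : 'I_#|C_poly (F i) (k i)|)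
                 (b' : 'I_#|C_poly (F i.+1) (k i.+1)|),
          b' = b :> nat ->
          map_poly (inc i.+1) (C_col (u i.+1 b')) = map_poly (inc i) (C_col (u i b))
      & embedding_family
          (fun i => row_perm (s i) (col_perm (u i) (C_mx (x i) (k i) (d i))))
          (fun i => C_X (x i) (k i) (d i) (inc i))
          (fun i => C_B (x i) (k i) (d i) (inc i))
          d].
Proof.
have x_uniq i : uniq (x i) by rewrite (perm_uniq (x_enum i)) enum_uniq.
have x_size i : d i * k i + 1 <= size (x i).
  rewrite (perm_size (x_enum i)) -cardE card_F.
  (* At 0 the bound is [q_ge]; later [qi_ge] gives it already for the preceding, smaller field. *)
  case: i => [|i]; first by rewrite expn0 expn1.
  apply: leq_trans (qi_ge i) _; apply: leq_pexp2l.
    by rewrite (leq_trans _ q_ge) // addn1.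
  by rewrite leq_exp2l.
have row_inj i : injective (fun a => pair_in (inc i) (@C_row _ (x i) (k i) (d i) a)).
  by move=> a b /pair_in_inj/enum_val_inj.
have row_nested i := nested_C_row (F_nested i) (k_mono i) (d_mono i) (x_size i) (x_prefix i).
have col_inj i := @C_col_inj _ (k i) _ (inc i).
have col_nested i := nested_C_col (F_nested i) (k_mono i).
(* Rows are labelled by points of [L * L] and columns by polynomials over [L], so labels from
   different stages can be compared. *)
have [s sP] := nested_labelling_perms row_inj row_nested.
have [u uP] := nested_labelling_perms col_inj col_nested.
exists s, u; split=> //; split=> i.
  by split; [apply: C_incidence | apply: C_CFF].
have le_t := leq_nested_labelling (row_inj i) (row_nested i).
have le_n := leq_nested_labelling (col_inj i) (col_nested i).
split=> //; first exact: nested_C_X.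
apply: extends_mx_entries => // a b a' b' aa' bb'; rewrite !mxE.
by apply: nested_horner_eq; [apply: sP | apply: uP].
Qed.
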